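(* Consider the ski rental problem with hierarchical prediction intervals: an integer purchase cost $B>1$, intervals $\Theta_i=[\ell_i,u_i]$ ($i\in[n]$) with $\ell_n\le\cdots\le\ell_1\le u_1\le\cdots\le u_n$, and accuracy parameters $1=\delta_0\ge\delta_1\ge\cdots\ge\delta_n\ge\delta_{n+1}=0$. Consider the linear program in the variables $(f_t)_{t\in\mathcal{I}}$, $(c_i)_{i\in[n+1]}$: $$\begin{aligned}\min\ & \sum_{i=1}^{n+1}(\delta_{i-1}-\delta_i)c_i\\ \text{s.t. } & \sum_{t=1}^{\tau}(t-1+B)f_t+\tau\Big(1-\sum_{t=1}^{\tau}f_t\Big)\le\min\{\tau,B\}\cdot c_{i(\tau)}\quad(\tau\in\mathcal{I}),\\ & c_i\le c_{i+1}\ (i\in[n]),\qquad \sum_{t\in\mathcal{I}}f_t=1,\\ & f_t\ge 0\ (t\in\mathcal{I}),\quad c_i\ge 0\ (i\in[n+1]).\end{aligned}$$ Then the optimal value of this linear program equals the minimum of $\mathrm{DRCR}_{\boldsymbol\Theta,\boldsymbol\delta}(A)$ over all randomized algorithms $A$. Moreover, for any optimal solution $((f_t)_{t\in\mathcal{I}},(c_i)_{i\in[n+1]})$ of the linear program, the randomized algorithm that buys on day $t$ with probability $f_t$ attains this minimum DRCR.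
   Context: $[n]=\{1,\dots,n\}$. Ski rental: the instance set $\mathcal{I}$ is the set of positive integers; an instance $\tau\in\mathcal{I}$ is the (unknown) last skiing day. Renting costs $1$ per day, buying costs $B$. The offline optimal cost is $\mathrm{OPT}(\tau)=\min\{\tau,B\}$. A randomized algorithm is given by $(f_t)_{t\in\mathcal{I}}$ with $f_t\ge 0$, $\sum_{t}f_t\le 1$, where $f_t$ is the probability of buying on day $t$ (and $1-\sum_t f_t$ the probability of never buying); its expected cost on $\tau$ is $\mathrm{ALG}(\tau)=\sum_{t=1}^{\tau}(t-1+B)f_t+\tau(1-\sum_{t=1}^{\tau}f_t)$. Each $\ell_i$ is a positive integer and each $u_i$ is a positive integer or $+\infty$; $\Theta_i=[\ell_i,u_i]$ is viewed as a subset of $\mathcal{I}$. Set $\Theta_0=\emptyset$, $\Theta_{n+1}=\mathcal{I}$. For $\tau\in\mathcal{I}$, $i(\tau)$ is the unique $i\in[n+1]$ with $\tau\in\Theta_i\setminus\Theta_{i-1}$. $\mathcal{D}_{\boldsymbol\Theta,\boldsymbol\delta}$ is the set of probability distributions $d$ on $\mathcal{I}$ with $\Pr_{\tau\sim d}[\tau\in\Theta_i]\ge 1-\delta_i$ for all $i\in[n]$, and $\mathrm{DRCR}_{\boldsymbol\Theta,\boldsymbol\delta}(A)=\sup_{d\in\mathcal{D}_{\boldsymbol\Theta,\boldsymbol\delta}}\mathbb{E}_{\tau\sim d}[\mathrm{ALG}(\tau)/\mathrm{OPT}(\tau)]$. *)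

(* Defs.v *)
From HB Require Import structures.
From mathcomp Require Import all_boot all_order all_algebra.
From mathcomp Require Import all_classical all_reals all_analysis.

Set Implicit Arguments.
Unset Strict Implicit.
Unset Printing Implicit Defensive.
Import Order.TTheory GRing.Theory Num.Theory.

Local Open Scope classical_set_scope.
Local Open Scope ring_scope.

(* Days, levels and interval indices are 1-based natural numbers. Sequences
   are functions on nat; their values outside the stated index range
   (e.g. f 0) are never read. *)

Definition instances : set nat := [set tau | (0 < tau)%N].

Definition is_minimum d (T : porderType d) (S : set T) (m : T) : Prop :=
  S m /\ lbound S m.

Section SkiRental.
Context {R : realType} (B : nat).

Definition OPT (tau : nat) : R := (minn tau B)%:R.

Definition ALG (f : nat -> R) (tau : nat) : R :=
  \sum_(1 <= t < tau.+1) (t%:R - 1 + B%:R) * f t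
  + tau%:R * (1 - \sum_(1 <= t < tau.+1) f t).

(* 1 - \sum_t f t is the probability of never buying. *)
Definition algorithms : set (nat -> R) :=
  [set f | (forall t, instances t -> 0 <= f t)
        /\ (\sum_(1 <= t <oo) (f t)%:E <= 1)%E].

End SkiRental.

Section Hierarchy.
Context (n : nat) (l : nat -> nat) (u : nat -> \bar int).

Definition Theta (i : nat) : set nat :=
  if i == 0 then set0
  else if (i <= n)%N then
    [set tau | instances tau /\ (l i <= tau)%N /\ (tau%:Z%:E <= u i)%E]
  else instances.

Definition is_level (tau i : nat) : Prop :=
  (1 <= i <= n.+1)%N /\ (Theta i `\` Theta i.-1) tau.

Definition level (tau : nat) : nat := get (is_level tau).

End Hierarchy.

(* A distribution on the instances is a probability measure on nat (with its
   discrete sigma-algebra) that is concentrated on the positive integers. *)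
Definition distributions {R : realType} (n : nat) (l : nat -> nat)
    (u : nat -> \bar int) (delta : nat -> R) : set (probability nat R) :=
  [set P | P instances = 1%E /\
    forall i, (1 <= i <= n)%N -> ((1 - delta i)%:E <= P (Theta n l u i))%E].

Definition DRCR {R : realType} (B n : nat) (l : nat -> nat)
    (u : nat -> \bar int) (delta : nat -> R) (f : nat -> R) : \bar R :=
  ereal_sup [set 'E_P[(fun tau => (ALG B f tau / OPT B tau)%R)]%E
            | P in distributions n l u delta].

Section LinearProgram.
Context {R : realType} (B n : nat) (l : nat -> nat) (u : nat -> \bar int).
Implicit Types f c delta : nat -> R.

Definition lp_feasible f c : Prop :=
  [/\ forall tau, instances tau ->
        ALG B f tau <= OPT B tau * c (level n l u tau),
      forall i, (1 <= i <= n)%N -> c i <= c i.+1,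
      (\sum_(1 <= t <oo) (f t)%:E = 1)%E,
      forall t, instances t -> 0 <= f t &
      forall i, (1 <= i <= n.+1)%N -> 0 <= c i].

Definition lp_objective delta c : R :=
  \sum_(1 <= i < n.+2) (delta i.-1 - delta i) * c i.

Definition lp_values delta : set R :=
  [set v | exists f c, lp_feasible f c /\ v = lp_objective delta c].

Definition lp_optimal delta f c : Prop :=
  lp_feasible f c /\ is_minimum (lp_values delta) (lp_objective delta c).

End LinearProgram.

(* Main.v *)
(** For an algorithm f with cost ratio r = ALG / OPT, put w_i = delta_(i-1) - delta_i.
    Abel summation along the nested intervals gives E_d[r] <= sum_i w_i c_i for
    every admissible d and every LP-feasible (f, c). Conversely, for any days
    s_i in Theta_i the mixture sum_i w_i * dirac(s_i) is admissible, so
    sum_i w_i r(s_i) <= DRCR(f), and c_i = sup_(Theta_i) r closes the gap. The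
    suprema may be infinite at levels of weight 0, where f has to be modified on
    days beyond the last level of positive weight; this also repairs a total mass
    smaller than 1. The minimum is attained because the functionals
    f |-> sum_i w_i r(s_i) are continuous on the compact product [0,1]^nat. *)

Require Import Defs.
From HB Require Import structures.
From mathcomp Require Import all_boot all_order all_algebra.
From mathcomp Require Import all_classical all_reals all_analysis.
From mathcomp Require Import ring zify.

Set Implicit Arguments.
Unset Strict Implicit.
Unset Printing Implicit Defensive.
Import Order.TTheory GRing.Theory Num.Theory.
Import numFieldNormedType.Exports.

Local Open Scope classical_set_scope.
Local Open Scope ring_scope.

(** * Cluster points and continuity for pointwise convergence *)

Lemma cluster_le {R : realType} (T : topologicalType) (G : set_system T) (p : T)
    (phi : T -> R) (a : R) :
  cluster G p -> {for p, continuous phi} -> G [set x | phi x <= a] -> phi p <= a.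
Proof.
move=> Gp phip Ga; rewrite leNgt; apply/negP => ap.
have [x [/= xa]] := Gp _ _ Ga (cvgr_gt _ phip _ ap).
by rewrite ltNge xa.
Qed.

Lemma continuous_coord {R : realType} (t : nat) : continuous (fun f : {ptws nat -> R} => f t).
Proof. exact: (@proj_continuous _ (fun=> R) t). Qed.

Lemma continuous_sum {R : realType} (T : topologicalType) (I : Type) (r : seq I) (h : I -> T -> R) :
  (forall i, continuous (h i)) -> continuous (fun x => \sum_(i <- r) h i x).
Proof.
by move=> hc; apply: continuous_big => //; exact: add_continuous.
Qed.

(** * Cost and competitive ratio of a single algorithm *)

Section SkiRentalCost.
Context {R : realType} (B : nat).
Implicit Types f : nat -> R.

(** Division by zero returns 0, so the ratio vanishes at the dummy day 0 and pointwise bounds can be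
    integrated over all of [nat]. *)
Definition ratio f (tau : nat) : R := ALG B f tau / OPT B tau.

Lemma ALG0 f : ALG B f 0 = 0.
Proof. by rewrite /ALG !big_geq// mul0r addr0. Qed.

Lemma ALGS f tau : ALG B f tau.+1 =
  ALG B f tau + (B%:R * f tau.+1 + (1 - \sum_(1 <= t < tau.+2) f t)).
Proof. by rewrite /ALG !(big_nat_recr tau.+1)//= -natr1; ring. Qed.

Lemma eq_ALG f g tau : (forall t, (0 < t <= tau)%N -> f t = g t) ->
  ALG B f tau = ALG B g tau.
Proof.
move=> fg; rewrite /ALG; congr (_ + _ * (1 - _));
  by apply: eq_big_nat => t ht; rewrite fg.
Qed.

(** Finite partial sums replace the series: each depends on finitely many coordinates, so its bound
    survives pointwise limits. *)
Lemma algorithmsP f : algorithms f <->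
  (forall t, (0 < t)%N -> 0 <= f t) /\
  (forall N, \sum_(1 <= t < N) f t <= 1).
Proof.
split=> -[f0 f1]; split=> //.
  move=> N; rewrite -lee_fin -sumEFin; apply: le_trans f1.
  by apply: nneseries_lim_ge => t t1 _; rewrite lee_fin f0.
apply: lime_le; first by apply: is_cvg_nneseries => t t1 _; rewrite lee_fin f0.
by apply: nearW => N; rewrite sumEFin lee_fin.
Qed.

Section Algorithm.
Context (f : nat -> R) (Af : algorithms f).

Let f_ge0 t : (0 < t)%N -> 0 <= f t.
Proof. by move: t; case/algorithmsP: Af. Qed.

Let psum_le1 N : \sum_(1 <= t < N) f t <= 1.
Proof. by move: N; case/algorithmsP: Af. Qed.

(** One more skiing day adds [B] times the probability of buying on it, plus the probability of not
    having bought by its end. *)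
Lemma ALG_nondecreasing : {homo ALG B f : s t / (s <= t)%N >-> s <= t}.
Proof.
apply: homo_leq => [x|y x z|tau]; [exact: lexx|exact: le_trans|].
rewrite ALGS lerDl addr_ge0 ?subr_ge0//.
by rewrite mulr_ge0// f_ge0.
Qed.

Lemma ALG_ge0 tau : 0 <= ALG B f tau.
Proof. by rewrite -(ALG0 f); exact: ALG_nondecreasing. Qed.

Lemma ratio_ge0 tau : 0 <= ratio f tau.
Proof. by rewrite divr_ge0// ?ALG_ge0// /OPT ler0n. Qed.

Lemma never_buy_le_ALG tau : tau%:R * (1 - \sum_(1 <= t < tau.+1) f t) <= ALG B f tau.
Proof.
rewrite /ALG lerDr big_nat_cond sumr_ge0// => t /andP[/andP[t1 _] _].
rewrite mulr_ge0 ?f_ge0// addr_ge0// subr_ge0 ler1n//.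
Qed.

End Algorithm.

Hypothesis B_gt0 : (0 < B)%N.

Lemma OPT_gt0 tau : (0 < tau)%N -> 0 < OPT B tau :> R.
Proof. by move=> t0; rewrite ltr0n leq_min t0. Qed.

Lemma OPT_ge1 tau : (0 < tau)%N -> 1 <= OPT B tau :> R.
Proof. by move=> t0; rewrite ler1n leq_min t0. Qed.

Lemma ratio_le_ALG f tau : algorithms f -> (0 < tau)%N -> ratio f tau <= ALG B f tau.
Proof.
move=> Af t0; rewrite ler_pdivrMr ?OPT_gt0// ler_peMr ?ALG_ge0//.
exact: OPT_ge1.
Qed.

Lemma ALG_le_ratio f tau : algorithms f -> (0 < tau)%N -> ALG B f tau <= ratio f tau * B%:R.
Proof.
move=> Af t0; rewrite -[leLHS](divfK (lt0r_neq0 (OPT_gt0 t0))).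
by rewrite ler_wpM2l ?ratio_ge0// ler_nat geq_minr.
Qed.

(* If [D] is bounded, all mass of [f] beyond the last day [N] of [D], including
   the probability of never buying, is moved to day [N.+1]. If [D] is unbounded,
   monotonicity of the cost bounds the ratio everywhere, which already forces
   the total mass to be [1]. *)
Lemma complete_algorithm f (D : set nat) (C : R) :
  D `<=` instances -> algorithms f -> (forall tau, D tau -> ratio f tau <= C) ->
  exists g, [/\ algorithms g, (\sum_(1 <= t <oo) (g t)%:E = 1)%E,
    forall tau, D tau -> ratio g tau = ratio f tau &
    exists C', forall tau, (0 < tau)%N -> ratio g tau <= C'].
Proof.
move=> D1 Af fC; have /algorithmsP[f0 f1] := Af.
have [[N DN]|] := pselect (exists N, forall tau, D tau -> (tau <= N)%N).
  pose g t := if (t <= N)%N then f t else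
    if t == N.+1 then 1 - \sum_(1 <= s < N.+1) f s else 0.
  have gf t : (t <= N)%N -> g t = f t by rewrite /g => ->.
  have gN t : (N.+1 < t)%N -> g t = 0.
    by move=> Nt; rewrite /g leqNgt (ltnW Nt)/= gtn_eqF.
  have g0 t : (0 < t)%N -> 0 <= g t.
    by move=> t0; rewrite /g; case: ifP => _; rewrite ?f0//; case: ifP => _; rewrite ?subr_ge0.
  have psumg M : (M <= N.+1)%N -> \sum_(1 <= t < M) g t = \sum_(1 <= t < M) f t.
    move=> MN; apply: eq_big_nat => t /andP[_ tM]; apply: gf; lia.
  have psumg1 M : (N.+1 < M)%N -> \sum_(1 <= t < M) g t = 1.
    elim: M => // M IH; rewrite ltnS leq_eqVlt => /orP[/eqP <-|NM].
      by rewrite big_nat_recr//= psumg// /g ltnn eqxx addrC subrK.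
    by rewrite big_nat_recr/= ?IH ?gN ?addr0//; move: NM; clear; case: M.
  have Ag : algorithms g.
    apply/algorithmsP; split=> // M; have [MN|NM] := leqP M N.+1.
      by rewrite psumg.
    by rewrite psumg1.
  exists g; split=> //.
  - apply/eqP; rewrite eq_le; case: (Ag) => _ -> /=.
    rewrite -[leLHS](_ : \sum_(1 <= t < N.+2) (g t)%:E = 1)%E.
      by apply: nneseries_lim_ge => t t1 _; rewrite lee_fin g0.
    by rewrite sumEFin psumg1.
  - move=> tau Dt; congr (_ / _); apply: eq_ALG => t /andP[_ tt].
    by apply: gf; exact: leq_trans (DN _ Dt).
  (* By the end of day [N.+1] the algorithm [g] has surely bought, so its cost is constant from
     there on. *)
  - exists (ALG B g N.+1) => tau t0; apply: le_trans (ratio_le_ALG Ag t0) _.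
    have [tN|Nt] := leqP tau N.+1; first exact: ALG_nondecreasing.
    elim: tau {t0} Nt => // tau IH; rewrite ltnS leq_eqVlt => /orP[/eqP <-|Nt].
      by rewrite ALGS gN// psumg1// subrr mulr0 !addr0.
    by rewrite ALGS gN ?psumg1 ?subrr ?mulr0 ?addr0 ?IH//; lia.
move=> unb.
have {}unb N : exists2 tau, D tau & (N < tau)%N.
  apply: contrapT => h; apply: unb; exists N => tau Dt.
  by rewrite leqNgt; apply/negP => Nt; apply: h; exists tau.
(* Some later day lies in [D], and monotonicity carries its bound back to [tau]; passing from ratio
   to cost loses at most a factor [B]. *)
have ALGC tau : ALG B f tau <= C * B%:R.
  have [t Dt tt] := unb tau.
  apply: le_trans (ALG_nondecreasing Af (ltnW tt)) _.
  apply: le_trans (ALG_le_ratio Af (D1 _ Dt)) _.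
  by rewrite ler_wpM2r// fC.
exists f; split=> //; last first.
  by exists (C * B%:R) => tau t0; apply: le_trans (ratio_le_ALG Af t0) _.
apply/eqP; rewrite eq_le; case: (Af) => _ -> /=.
apply/lee_addgt0Pr => e e0.
(* [N] is so large that a cost of at most [C * B] leaves probability less than [e] of not having
   bought by day [N]. *)
have [N hN] : exists N : nat, C * B%:R / e < N%:R.
  exists (Num.bound (C * B%:R / e)); apply: archi_boundP.
  by rewrite divr_ge0 ?(ltW e0)//; apply: le_trans (ALG_ge0 Af 0) _.
have hs : 1 <= \sum_(1 <= t < N.+1) f t + e.
  have := le_trans (never_buy_le_ALG Af N) (ALGC N).
  have N0 : 0 < N%:R :> R.
    apply: le_lt_trans hN; rewrite divr_ge0 ?(ltW e0)//.
    by apply: le_trans (ALG_ge0 Af 0) _.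
  move=> /le_lt_trans; move: hN; rewrite ltr_pdivrMr// => hN /(_ _ hN).
  by rewrite ltr_pM2l// => /ltW; rewrite lerBlDl.
apply: (@le_trans _ _ ((\sum_(1 <= t < N.+1) f t)%:E + e%:E)%E).
  by rewrite -EFinD lee_fin.
rewrite leeD2r// -sumEFin.
by apply: nneseries_lim_ge => t t1 _; rewrite lee_fin f0.
Qed.

End SkiRentalCost.

(** * Nested intervals and levels *)

Section Hierarchy.
Context (n : nat) (l : nat -> nat) (u : nat -> \bar int).
Hypotheses (l_gt0 : forall i, (1 <= i <= n)%N -> (0 < l i)%N)
  (l_noninc : forall i, (1 <= i < n)%N -> (l i.+1 <= l i)%N)
  (l_le_u : (1 <= n)%N -> ((l 1%N)%:Z%:E <= u 1%N)%E)
  (u_nondec : forall i, (1 <= i < n)%N -> (u i <= u i.+1)%E).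

Lemma Theta_instances i : Theta n l u i `<=` instances.
Proof. by rewrite /Theta; case: ifP => _; [|case: ifP => _ tau []]. Qed.

Lemma ThetaSn : Theta n l u n.+1 = instances.
Proof. by rewrite /Theta ltnn. Qed.

Lemma Theta_subset i j : (i <= j)%N -> Theta n l u i `<=` Theta n l u j.
Proof.
move: i j; apply: homo_leq => [A|B A C|i]; [exact: subset_refl|exact: subset_trans|].
have [->|] := posnP i; first by rewrite {1}/Theta eqxx.
rewrite /Theta/= => i0; rewrite eqn0Ngt i0/=; case: (ltnP i n) => [iN|_]; last by case: ifP => // _ ? [].
rewrite (ltnW iN) => tau [t0 [lt tu]]; split=> //; split.
  by apply: leq_trans lt; rewrite l_noninc// i0.
by apply: le_trans tu _; rewrite u_nondec// i0.
Qed.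

Lemma Theta_nonempty i : (0 < i)%N -> Theta n l u i !=set0.
Proof.
move=> i0; apply: subset_nonempty (Theta_subset i0) _.
rewrite /Theta/=; case: ifP => n1; last by exists 1%N.
by exists (l 1); split; [exact: l_gt0|split=> //; exact: l_le_u].
Qed.

(** [level] is a [get], so a witness is needed: the least index whose interval contains [tau].
    Minimality excludes the preceding interval. *)
Lemma levelP tau : instances tau -> is_level n l u tau (level n l u tau).
Proof.
move=> t0; have : exists i, `[< Theta n l u i tau >].
  by exists n.+1; apply/asboolP; rewrite ThetaSn.
move=> /ex_minnP[i /asboolP it imin]; apply: (@getPex _ (is_level n l u tau)).
exists i; split; last first.
  split=> // it'; have := imin i.-1; rewrite asboolT// => /(_ erefl).
  by case: i it {it' imin} => [|i _] /=; [rewrite /Theta eqxx|rewrite ltnn].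
apply/andP; split; first by case: i it {imin}; rewrite // /Theta eqxx.
by apply: imin; apply/asboolP; rewrite ThetaSn.
Qed.

Lemma Theta_level i tau : instances tau ->
  Theta n l u i tau <-> (level n l u tau <= i)%N.
Proof.
move=> t0; have [/andP[L1 _] [tL tL1]] := levelP t0.
split=> [ti|/Theta_subset]; last exact.
rewrite leqNgt; apply/negP => iL; apply: tL1.
by apply: Theta_subset ti; rewrite -ltnS prednK.
Qed.

End Hierarchy.

(** Summation by parts: when [delta 0 = 1], the factor [delta 0 - delta i] is the probability
    guaranteed for the [i]-th interval, so admissibility applies term by term. *)
Lemma lp_objective_Abel {R : realType} (n : nat) (delta c : nat -> R) :
  lp_objective n delta c = (delta 0 - delta n.+1) * c n.+1 -
    \sum_(1 <= i < n.+1) (c i.+1 - c i) * (delta 0 - delta i).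
Proof.
rewrite /lp_objective; elim: n => [|n IH].
  by rewrite big_nat1 big_geq// subr0.
by rewrite big_nat_recr//= IH [in RHS]big_nat_recr//=; ring.
Qed.

(** * Comparison of [DRCR] with LP objectives, from both sides *)

Section Upper.
Context {R : realType} (B n : nat) (l : nat -> nat) (u : nat -> \bar int)
  (delta : nat -> R).
Hypotheses (B_gt0 : (0 < B)%N)
  (l_noninc : forall i, (1 <= i < n)%N -> (l i.+1 <= l i)%N)
  (u_nondec : forall i, (1 <= i < n)%N -> (u i <= u i.+1)%E)
  (delta0 : delta 0%N = 1) (deltaS : delta n.+1 = 0).
Implicit Types f c : nat -> R.

Lemma lp_feasible_algorithm f c : lp_feasible B n l u f c -> algorithms f.
Proof. by case=> _ _ f1 f0 _; split=> //; rewrite f1. Qed.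

(** At an instance of level [L] the indicator sum telescopes to [c n.+1 - c L], which leaves the LP
    constraint at [tau]. With the increments on the left, only nonnegative functions have to be
    integrated. *)
Lemma lp_feasible_ratio f c (tau : nat) : lp_feasible B n l u f c ->
  ratio B f tau + \sum_(1 <= i < n.+1) (c i.+1 - c i) * \1_(Theta n l u i) tau
  <= c n.+1.
Proof.
move=> [fc cS _ _ c0].
have [t0|] := ltnP 0 tau; last first.
  rewrite leqn0 => /eqP ->; rewrite /ratio ALG0 mul0r add0r big1 ?c0 ?leqnn// => i _.
  rewrite indicE (_ : _ \in _ = false) ?mulr0//; apply/negbTE/negP.
  by rewrite inE => /Theta_instances.
have [/andP[L1 Ln] _] := levelP n l u t0.
rewrite (big_cat_nat L1 Ln)/= big_nat_cond big1 ?add0r; last first.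
  move=> i /andP[/andP[_ iL] _].
  rewrite indicE (_ : _ \in _ = false) ?mulr0//; apply/negbTE/negP.
  by rewrite inE => /(Theta_level l_noninc u_nondec _ t0); rewrite leqNgt iL.
rewrite (eq_big_nat _ _ (F2 := fun i => c i.+1 - c i)); last first.
  move=> i /andP[Li _]; rewrite indicE mem_set ?mulr1//.
  exact/(Theta_level l_noninc u_nondec _ t0).
rewrite telescope_sumr// addrCA gerDl subr_le0.
by rewrite /ratio ler_pdivrMr ?OPT_gt0// mulrC fc.
Qed.

Lemma DRCR_le_lp_objective f c : lp_feasible B n l u f c ->
  (DRCR B n l u delta f <= (lp_objective n delta c)%:E)%E.
Proof.
move=> fc; have Af := lp_feasible_algorithm fc; have [_ cS _ _ _] := fc.
apply: ge_ereal_sup => _ [P [_ PTheta] <-].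
rewrite unlock -/(ratio B f _) lp_objective_Abel delta0 deltaS subr0 mul1r.
rewrite EFinB leeBrDr//.
(* The absolute value gives nonnegative integrands for every index, also outside the range where [c]
   is known to be monotone. *)
pose a i := `|c i.+1 - c i|.
have aE i : (1 <= i < n.+1)%N -> c i.+1 - c i = a i.
  by move=> hi; rewrite /a ger0_norm// subr_ge0 cS.
pose h i (tau : nat) := ((a i * \1_(Theta n l u i) tau)%:E : \bar R).
have h0 i tau : (0 <= h i tau)%E by rewrite lee_fin mulr_ge0 ?normr_ge0 ?indicE ?ler0n.
have : (\int[P]_tau ((ratio B f tau)%:E + \sum_(1 <= i < n.+1) h i tau)
    <= \int[P]_tau (cst (c n.+1)%:E tau))%E.
  apply: ge0_le_integral => //; [move=> tau _|move=> tau _].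
  - by rewrite adde_ge0 ?sume_ge0// lee_fin ratio_ge0.
  - rewrite sumEFin lee_fin; apply: le_trans (lp_feasible_ratio tau fc).
    by rewrite lerD2l; apply: ler_sum_nat => i hi; rewrite aE.
rewrite integral_cst// [X in (_ * X)%E]probability_setT mule1; apply: le_trans.
rewrite ge0_integralD//; last 2 first.
  - by move=> tau _; rewrite lee_fin ratio_ge0.
  - by move=> tau _; rewrite sume_ge0.
rewrite leeD2l// ge0_integral_sum// -sumEFin.
rewrite big_nat_cond [leRHS]big_nat_cond; apply: lee_sum => i /andP[hi _].
rewrite aE// /h; under eq_integral do rewrite EFinM.
rewrite ge0_integralZl//; last by rewrite lee_fin normr_ge0.
rewrite integral_indic// setIT EFinM; apply: lee_wpmul2l; last exact: PTheta.
by rewrite lee_fin normr_ge0.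
Qed.

(** The mixture of point masses is admissible because its first [i] weights sum to [1 - delta i] and
    sit on days inside the [i]-th interval. *)
Lemma lp_objective_le_DRCR f (s : nat -> nat) : (forall i, (i <= n)%N -> delta i.+1 <= delta i) -> algorithms f ->
  (forall i, (1 <= i <= n.+1)%N -> Theta n l u i (s i)) ->
  ((lp_objective n delta (ratio B f \o s))%:E <= DRCR B n l u delta f)%E.
Proof.
move=> dS Af sTheta.
(* Indices are shifted by one: [w i] is the weight of the day [s i.+1]. *)
pose w i : {nonneg R} := NngNum (normr_ge0 (delta i - delta i.+1)).
have wE i : (i < n.+1)%N -> (w i)%:num = delta i - delta i.+1.
  by move=> hi; rewrite /w/= ger0_norm// subr_ge0 dS.
pose Q := msum (fun i => mscale (w i) (\d_(s i.+1) : {measure set nat -> \bar R})) n.+1.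
have QE (A : set nat) : Q A = (\sum_(i < n.+1) (w i)%:num%:E * \d_(s i.+1) A)%E.
  by [].
have sumw m : (m <= n.+1)%N -> \sum_(i < m) (w i)%:num = 1 - delta m.
  move=> mn; rewrite -(big_mkord xpredT (fun i => (w i)%:num)).
  rewrite (eq_big_nat _ _ (F2 := fun i => - delta i.+1 - - delta i)).
    by rewrite telescope_sumr// delta0 opprK addrC.
  by move=> i /andP[_ im]; rewrite wE ?opprK 1?addrC//; exact: leq_trans im mn.
have Q1 : Q setT = 1%E.
  rewrite QE (eq_bigr (fun i : 'I_n.+1 => (w i)%:num%:E)).
    by rewrite sumEFin sumw// deltaS subr0.
  by move=> i _; rewrite diracT mule1.
pose P : probability nat R := HB.pack Q (Measure_isProbability.Build _ _ _ Q Q1).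
apply: ereal_sup_ubound; exists P; last first.
  rewrite unlock /=.
  transitivity (\int[Q]_tau (ratio B f tau)%:E)%E; first by [].
  rewrite ge0_integral_measure_sum//; last by move=> tau _; rewrite lee_fin ratio_ge0.
  rewrite /lp_objective big_add1/= big_mkord -sumEFin; apply: eq_bigr => i _.
  rewrite ge0_integral_mscale//; last by move=> tau _; rewrite lee_fin ratio_ge0.
  by rewrite integral_dirac// diracT mul1e -EFinM wE.
split.
  rewrite -Q1 /= !QE; apply: eq_bigr => i _; rewrite diracT diracE mem_set//.
  by apply: Theta_instances (sTheta _ _); rewrite ltnS ltn_ord.
move=> i /andP[i1 iN] /=; rewrite QE.
rewrite -(big_mkord xpredT (fun j => (w j)%:num%:E * \d_(s j.+1) (Theta n l u i))%E).
rewrite (big_cat_nat (leq0n i))/=; last exact: leqW.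
rewrite -[leLHS]adde0 leeD//; last by apply: sume_ge0 => j _; rewrite mule_ge0 ?lee_fin.
rewrite -sumw ?leqW// -sumEFin big_mkord; apply: lee_sum => j _.
rewrite diracE mem_set ?mule1//.
apply: (Theta_subset l_noninc u_nondec (ltn_ord j)); apply: sTheta.
by have := ltn_ord j; lia.
Qed.
End Upper.

(** * Existence of an optimal algorithm and of a matching LP solution *)

Section Lower.
Context {R : realType} (B n : nat) (l : nat -> nat) (u : nat -> \bar int)
  (delta : nat -> R).
Hypotheses (B_gt0 : (0 < B)%N)
  (l_gt0 : forall i, (1 <= i <= n)%N -> (0 < l i)%N)
  (l_noninc : forall i, (1 <= i < n)%N -> (l i.+1 <= l i)%N)
  (l_le_u : (1 <= n)%N -> ((l 1%N)%:Z%:E <= u 1%N)%E)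
  (u_nondec : forall i, (1 <= i < n)%N -> (u i <= u i.+1)%E)
  (delta0 : delta 0%N = 1)
  (delta_noninc : forall i, (i <= n)%N -> delta i.+1 <= delta i)
  (deltaS : delta n.+1 = 0).
Implicit Types f c : nat -> R.

Let Theta_ := Theta n l u.

(** The days carrying the finite mixtures against which an algorithm is tested. *)
Definition selection (s : nat -> nat) :=
  forall i, (1 <= i <= n.+1)%N -> Theta_ i (s i).

Let cost f s := lp_objective n delta (ratio B f \o s).

Lemma exists_selection : exists s, selection s.
Proof.
exists (fun i => get (Theta_ i)) => i /andP[i0 _].
by apply: getPex; exact: Theta_nonempty.
Qed.

(** Levels of weight 0 are exempt from the comparison, so an algorithm may be altered beyond the
    last level of positive weight. *)
Lemma lp_objective_le c d :
  (forall i, (1 <= i <= n.+1)%N -> delta i < delta i.-1 -> c i <= d i) ->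
  lp_objective n delta c <= lp_objective n delta d.
Proof.
move=> cd; rewrite /lp_objective big_nat_cond [leRHS]big_nat_cond.
apply: ler_sum => i /andP[hi _].
have : delta i <= delta i.-1.
  by case: i hi => // i /andP[_ iN]; exact: delta_noninc.
rewrite le_eqVlt => /predU1P[->|di]; first by rewrite subrr !mul0r.
by rewrite ler_wpM2l ?subr_ge0 ?(ltW di)// cd.
Qed.

Lemma lp_objectiveD_cst c a : lp_objective n delta (fun i => c i + a) =
  lp_objective n delta c + a.
Proof.
rewrite lp_objective_Abel [in RHS]lp_objective_Abel delta0 deltaS.
rewrite (eq_bigr (fun i => (c i.+1 - c i) * (1 - delta i))) => [|i _]; ring.
Qed.

Lemma lp_objective_cst a : lp_objective n delta (fun=> a) = a.
Proof.
rewrite -[RHS]add0r -[X in X + _](_ : lp_objective n delta (fun=> 0) = 0).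
  by rewrite -lp_objectiveD_cst /lp_objective; apply: eq_bigr => i _; rewrite add0r.
by rewrite /lp_objective big1// => i _; rewrite mulr0.
Qed.

Lemma delta_le i j : (i <= j <= n.+1)%N -> delta j <= delta i.
Proof.
elim: j => [|j IH]; first by rewrite leqn0 => /andP[/eqP ->].
rewrite leq_eqVlt => /andP[/predU1P[-> //|ij] jn].
by apply: (le_trans (delta_noninc _)) => //; apply: IH; lia.
Qed.

(** [k] is the first index at which [delta] vanishes: [delta k.-1] is still positive, and by
    monotonicity all later weights are 0. *)
Lemma exists_last_weight : exists2 k, (1 <= k <= n.+1)%N &
  delta k < delta k.-1 /\
  forall i, (1 <= i <= n.+1)%N -> delta i < delta i.-1 -> (i <= k)%N.
Proof.
have : exists k, delta k == 0 by exists n.+1; rewrite deltaS.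
move=> /ex_minnP[k /eqP dk kmin].
have kn : (k <= n.+1)%N by apply: kmin; rewrite deltaS.
have k0 : (0 < k)%N.
  by rewrite lt0n; apply/eqP => k0; move: dk; rewrite k0 delta0 => /eqP; rewrite oner_eq0.
exists k; first by rewrite k0.
split.
  rewrite dk lt_neqAle -{2}deltaS delta_le ?andbT; last by lia.
  by rewrite eq_sym; apply/negP => /kmin; rewrite leqNgt prednK// leqnn.
move=> i /andP[i1 iN]; apply: contraTT; rewrite -ltnNge -leNgt => ki.
have -> : delta i.-1 = 0.
  apply/eqP; rewrite eq_le -{1}dk -deltaS !delta_le//; lia.
by rewrite -deltaS delta_le// iN leqnn.
Qed.

(** The bound on mixtures caps the ratio on the [k]-th interval, [k] being the last level of
    positive weight. Completing [f] relative to that interval gives [g] with a globally bounded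
    ratio, so the suprema taken as [c] are finite. *)
Lemma exists_lp_feasible f M : algorithms f ->
  (forall s, selection s -> cost f s <= M) ->
  exists g c, lp_feasible B n l u g c /\ lp_objective n delta c <= M.
Proof.
move=> Af fM; have [k kn [dk klast]] := exists_last_weight.
have [s0 s0Theta] := exists_selection.
have fC tau : Theta_ k tau -> ratio B f tau <= M / (delta k.-1 - delta k).
  move=> ktau; rewrite ler_pdivlMr ?subr_gt0//.
  (* All terms of the objective are nonnegative; keeping only the [k]-th one isolates the ratio at
     an arbitrary [tau]. *)
  pose s i := if i == k then tau else s0 i.
  have sTheta : selection s.
    by move=> i hi; rewrite /s; case: eqP => [->//|_]; exact: s0Theta.
  apply: le_trans (fM s sTheta); rewrite mulrC.
  rewrite /cost /lp_objective (bigD1_seq k) ?iota_uniq ?mem_index_iota//=.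
  rewrite /s eqxx lerDl big_seq_cond sumr_ge0// => i.
  rewrite mem_index_iota => /andP[hi _]; rewrite mulr_ge0 ?ratio_ge0//.
  by rewrite subr_ge0 delta_le//; lia.
have [g [Ag g1 gf [C gC]]] := complete_algorithm B_gt0 (@Theta_instances n l u k) Af fC.
pose V i := ratio B g @` Theta_ i.
have V0 i : (0 < i)%N -> V i !=set0.
  move=> i0; have [tau it] := Theta_nonempty l_gt0 l_noninc l_le_u u_nondec i0.
  by exists (ratio B g tau), tau.
have VC i : has_ubound (V i).
  by exists C => _ [tau it <-]; apply: gC; exact: Theta_instances it.
exists g, (fun i => sup (V i)); split.
  split=> //.
  - move=> tau t0; rewrite mulrC -ler_pdivrMr ?OPT_gt0//.
    apply: ub_le_sup => //; exists tau => //.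
    by case: (levelP n l u t0) => _ [].
  - move=> i /andP[i0 iN]; apply: ge_sup; first exact: V0.
    move=> _ [tau it <-]; apply: ub_le_sup => //; exists tau => //.
    exact: Theta_subset (leqnSn i) _ it.
  - by case/algorithmsP: Ag.
  - move=> i /andP[i0 _]; have [r Vr] := V0 i i0.
    apply: le_trans (ub_le_sup (VC i) Vr); case: Vr => tau _ <-.
    exact: ratio_ge0.
apply/ler_addgt0Pr => e e0.
(* Days attaining each supremum up to [e]; the total loss is again [e], since the weights sum to
   1. *)
have /choice[s sP] : forall i, exists tau, (0 < i)%N ->
    Theta_ i tau /\ sup (V i) <= ratio B g tau + e.
  move=> [|i]; first by exists 0%N.
  have [_ [tau it <-] h] := sup_adherent e0 (conj (V0 i.+1 isT) (VC i.+1)).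
  by exists tau => _; split=> //; rewrite -lerBlDr ltW.
have sTheta : selection s by move=> i /andP[/sP[]].
apply: (@le_trans _ _ (cost f s + e)); last by rewrite lerD2r fM.
rewrite -lp_objectiveD_cst; apply: lp_objective_le => i hi di.
have /andP[i0 _] := hi; have [si] := sP i i0.
(* At positive weight the interval lies inside the [k]-th one, where [g] and [f] have the same
   ratio. *)
rewrite gf//; exact: Theta_subset (klast i hi di) _ si.
Qed.

Let F := {ptws nat -> R}.

(** For fixed [tau] the cost is affine in finitely many coordinates of [f]. *)
Lemma continuous_ALG tau : continuous (fun f : F => ALG B f tau).
Proof.
pose psum (f : F) := \sum_(1 <= t < tau.+1) f t.
pose buy (f : F) :=
  \sum_(1 <= t < tau.+1) (t%:R - 1 + B%:R) * f t.
have psum_cont : continuous psum.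
  by apply: continuous_sum => t; exact: continuous_coord.
have buy_cont : continuous buy.
  apply: continuous_sum => t f.
  by apply: (@cvgMl_tmp R F (nbhs f) _ (fun g : F => g t)); exact: continuous_coord.
move=> f.
have never_cvg : 1 - psum g @[g --> f] --> 1 - psum f.
  by apply: (@cvgB R R F (nbhs f) _ (cst 1) psum); [exact: cvg_cst|exact: psum_cont].
apply: (@cvgD R R F (nbhs f) _ buy (fun g : F => tau%:R * (1 - psum g))).
  exact: buy_cont.
exact: (@cvgMl_tmp R F (nbhs f) _ (fun g : F => 1 - psum g) tau%:R (1 - psum f)).
Qed.

Lemma continuous_cost s : continuous (fun f : F => cost f s).
Proof.
apply: continuous_sum => i f.
apply: (@cvgMl_tmp R F (nbhs f) _ (fun g : F => ratio B g (s i))).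
apply: (@cvgMr_tmp R F (nbhs f) _ (fun g : F => ALG B g (s i))).
exact: continuous_ALG.
Qed.

(** Near-optimal algorithms generate a filter on the compact cube; all constraints are closed, so
    they pass to a cluster point. *)
Lemma exists_min_cost : exists f M, [/\ algorithms f,
  forall s, selection s -> cost f s <= M &
  forall g N, algorithms g -> (forall s, selection s -> cost g s <= N) -> M <= N].
Proof.
(* Coordinate 0 is not constrained by [algorithms]; pinning it to 0 keeps the sequences in the unit
   cube. *)
pose below (a : R) := [set f : F | [/\ algorithms f, f 0%N = 0 &
  forall s, selection s -> cost f s <= a]].
have FP g a : algorithms g -> (forall s, selection s -> cost g s <= a) ->
    below a !=set0.
  move=> Ag ga; pose g' t := if t is 0%N then 0 else g t.
  have gE t : (0 < t)%N -> g' t = g t by case: t.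
  exists g'; split=> //.
    apply/algorithmsP; case/algorithmsP: Ag => g0 g1; split=> [t t0|N].
      by rewrite gE// g0.
    apply: le_trans (g1 N); rewrite le_eqVlt; apply/orP; left; apply/eqP.
    by apply: eq_big_nat => t /andP[t1 _]; rewrite gE.
  move=> s sTheta; apply: le_trans (ga s sTheta).
  apply: lp_objective_le => i _ _ /=; rewrite /ratio (@eq_ALG _ _ g' g)//.
  by move=> t /andP[t0 _]; exact: gE.
pose V := [set a | below a !=set0].
have V0 : V !=set0.
  have A0 : algorithms (fun=> 0 : R) by apply/algorithmsP; split=> // N; rewrite big1.
  (* Completing the zero algorithm relative to the empty set yields an algorithm of bounded ratio,
     so [V] is nonempty. *)
  have [g [Ag _ _ [C gC]]] := complete_algorithm B_gt0 (sub0set _) A0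
    (fun tau (t0 : set0 tau) => False_ind (ratio B _ tau <= 0) t0).
  exists C; apply: (FP g) => // s sTheta.
  rewrite -[leRHS]lp_objective_cst; apply: lp_objective_le => i hi _ /=.
  by apply: gC; exact: Theta_instances (sTheta i hi).
have Vlb : has_lbound V.
  have [s sTheta] := exists_selection.
  exists 0 => a [f [Af _ /(_ s sTheta)]]; apply: le_trans.
  rewrite -(lp_objective_cst 0); apply: lp_objective_le => i _ _.
  exact: ratio_ge0.
pose m := inf V.
have Fm (e : R) : 0 < e -> below (m + e) !=set0.
  move=> e0; have [a [f [Af f0 fa]] ame] := inf_adherent e0 (conj V0 Vlb).
  exists f; split=> // s sTheta; apply: le_trans (fa s sTheta) (ltW ame).
pose G := filter_from [set e : R | 0 < e] (fun e => below (m + e)).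
have GF : ProperFilter G.
  apply: filter_from_proper; last by move=> e; exact: Fm.
  apply: filter_from_filter; first by exists 1 => /=.
  move=> e1 e2 /= e10 e20; exists (Num.min e1 e2) => /=.
    by rewrite lt_min e10.
  move=> f [Af f0 fa]; split; split=> // s sTheta; apply: le_trans (fa s sTheta) _;
    by rewrite lerD2l ge_min lexx ?orbT.
have [f [_ Gf]] : [set f : F | forall t, `[0, 1]%classic (f t)] `&`
    cluster G !=set0.
  apply: (@tychonoff nat (fun=> R) (fun=> `[0, 1]%classic)) => //.
    by move=> _; exact: segment_compact.
  exists 1 => //= f [/algorithmsP[f0 f1] f00 _] [|t] /=; rewrite in_itv/= ?f00 ?lexx ?ler01//.
  rewrite f0//=; apply: le_trans (f1 t.+2).
  rewrite big_nat_recr//= lerDr big_nat_cond sumr_ge0// => i /andP[/andP[i0 _] _].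
  exact: f0.
have GFe (e : R) (A : set F) : 0 < e -> below (m + e) `<=` A -> G A.
  by move=> e0 FA; exists e.
exists f, m; split.
- apply/algorithmsP; split=> [t t0|N].
    rewrite -oppr_le0; apply: (@cluster_le R F G f (fun g => - g t) 0 Gf).
      apply: (@cvgN R R F (nbhs f) _ (fun g : F => g t)).
      exact: continuous_coord.
    apply: (GFe 1) => // h [/algorithmsP[h0 _] _ _] /=.
    by rewrite oppr_le0 h0.
  apply: (@cluster_le R F G f (fun g => \sum_(1 <= t < N) g t) 1 Gf).
    by apply: continuous_sum => t; exact: continuous_coord.
  by apply: (GFe 1) => // h [/algorithmsP[_ h1] _ _] /=.
(* [below (m + e)] belongs to [G] for every positive [e], so the cluster point has cost at most
   [m + e]. *)
- move=> s sTheta; apply/ler_addgt0Pr => e e0.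
  apply: (@cluster_le R F G f (fun g => cost g s) (m + e) Gf); first exact: continuous_cost.
  by apply: (GFe e) => // h [_ _ hs] /=; exact: hs.
- by move=> g N Ag gN; apply: ge_inf => //; exact: (FP g).
Qed.

Lemma min_DRCR : exists g c M, [/\ lp_feasible B n l u g c,
  lp_objective n delta c <= M &
  forall f, algorithms f -> (M%:E <= DRCR B n l u delta f)%E].
Proof.
have [f [M [Af fM Mmin]]] := exists_min_cost.
have [g [c [gc cM]]] := exists_lp_feasible Af fM.
exists g, c, M; split=> // h Ah.
have hD s : selection s -> ((cost h s)%:E <= DRCR B n l u delta h)%E.
  exact: lp_objective_le_DRCR.
(* Minimality of [M] settles finite values; the value [-oo] is excluded because a selection
   exists. *)
case: (DRCR B n l u delta h) hD => [r| |] hD; first last.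
- by have [s /hD] := exists_selection; rewrite leeNy_eq.
- exact: leey.
by rewrite lee_fin; apply: (Mmin h) => // s /hD; rewrite lee_fin.
Qed.

End Lower.

Theorem mainTheorem4 (R : realType) (B n : nat)
    (l : nat -> nat) (u : nat -> \bar int) (delta : nat -> R)
    (B_gt1 : (1 < B)%N)
    (l_gt0 : forall i, (1 <= i <= n)%N -> (0 < l i)%N)
    (u_gt0 : forall i, (1 <= i <= n)%N -> (0 < u i)%E)
    (l_noninc : forall i, (1 <= i < n)%N -> (l i.+1 <= l i)%N)
    (l_le_u : (1 <= n)%N -> ((l 1%N)%:Z%:E <= u 1%N)%E)
    (u_nondec : forall i, (1 <= i < n)%N -> (u i <= u i.+1)%E)
    (delta0 : delta 0%N = 1)
    (delta_noninc : forall i, (i <= n)%N -> delta i.+1 <= delta i)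
    (deltaS : delta n.+1 = 0) :
  (exists v : R,
      is_minimum (lp_values B n l u delta) v
      /\ is_minimum (DRCR B n l u delta @` algorithms) v%:E)
  /\ (forall f c : nat -> R, lp_optimal B n l u delta f c ->
        algorithms f
        /\ is_minimum (DRCR B n l u delta @` algorithms)
             (DRCR B n l u delta f)).
Proof.
have B_gt0 := ltnW B_gt1.
have [g [c [M [gc cM Mmin]]]] := min_DRCR B_gt0 l_gt0 l_noninc l_le_u u_nondec
  delta0 delta_noninc deltaS.
have DRCRle f d : lp_feasible B n l u f d ->
    (DRCR B n l u delta f <= (lp_objective n delta d)%:E)%E.
  exact: DRCR_le_lp_objective.
(* [M] is at most the [DRCR] of [f], which in turn is at most the LP objective. *)
have Mle f d : lp_feasible B n l u f d -> M <= lp_objective n delta d.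
  move=> fd; rewrite -lee_fin; apply: le_trans (DRCRle _ _ fd).
  by apply: Mmin; exact: lp_feasible_algorithm fd.
have cE : lp_objective n delta c = M by apply/eqP; rewrite eq_le cM (Mle g).
have lpM : is_minimum (lp_values B n l u delta) M.
  split; first by exists g, c.
  by move=> _ [f [d [fd ->]]]; exact: Mle fd.
have DRCRM f : algorithms f -> (DRCR B n l u delta f <= M%:E)%E ->
    DRCR B n l u delta f = M%:E.
  by move=> Af fM; apply/eqP; rewrite eq_le fM Mmin.
have minM : is_minimum (DRCR B n l u delta @` algorithms) M%:E.
  split; last by move=> _ [f Af <-]; exact: Mmin.
  have Ag := lp_feasible_algorithm gc.
  by exists g => //; apply: DRCRM => //; rewrite -cE; exact: DRCRle.
split; first by exists M.
move=> f d [fd [_ dmin]]; have Af := lp_feasible_algorithm fd; split=> //.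
(* LP optimality caps the objective of [d] by [M], which squeezes the [DRCR] of [f] to [M]. *)
rewrite (DRCRM f Af)//; apply: le_trans (DRCRle _ _ fd) _.
by rewrite lee_fin; apply: dmin; case: lpM.
Qed.
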